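(* Let $1<\alpha\le 3/2$, $\lambda\in\mathbb{C}$ with $|\lambda|\le\frac12$, and $\delta\in\mathbb{C}$. Let $f=h+\overline{g}\in\mathcal{F}(\alpha,\lambda)$ with $g(z)=\sum_{k=1}^{\infty}b_kz^k$. Then $$\left|b_3-\delta b_2^2\right|\le\frac{2(\alpha-1)|\lambda|}{3}+\frac{|\delta||\lambda|^2}{4}.$$ The inequality is sharp.
   Context: $\mathbb{D}=\{z\in\mathbb{C}:|z|<1\}$. $\mathcal{H}$ is the class of harmonic functions $f=h+\overline{g}$ in $\mathbb{D}$, with $h,g$ analytic in $\mathbb{D}$, normalized by $f(0)=f_z(0)-1=0$, of the form $f(z)=z+\sum_{k=2}^{\infty}a_kz^k+\overline{\sum_{k=1}^{\infty}b_kz^k}$. For $1<\alpha\le 3/2$ and $\lambda\in\mathbb{C}$ with $|\lambda|\le\frac12$, $\mathcal{F}(\alpha,\lambda)$ is the class of $f=h+\overline{g}\in\mathcal{H}$ such that $\mathrm{Re}\left(1+\frac{zh''(z)}{h'(z)}\right)<\alpha$ and $g'(z)=\lambda zh'(z)$ for all $z\in\mathbb{D}$. *)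

(* Defs.v *)
From Stdlib Require Import Reals.
From Coquelicot Require Export Coquelicot.
Local Open Scope R_scope.

Definition unit_disk (z : C) : Prop := Cmod z < 1.

Definition analytic_in_disk (f : C -> C) : Prop :=
  forall z : C, unit_disk z -> @ex_derive C_AbsRing C_NormedModule f z.

Definition partial_x (f : C -> C) (z : C) : C :=
  (Derive (fun t : R => Re (f (t, Im z))) (Re z),
   Derive (fun t : R => Im (f (t, Im z))) (Re z)).

Definition partial_y (f : C -> C) (z : C) : C :=
  (Derive (fun t : R => Re (f (Re z, t))) (Im z),
   Derive (fun t : R => Im (f (Re z, t))) (Im z)).

(* The Wirtinger derivative f_z = (f_x - i f_y) / 2. *)
Definition wirtinger_dz (f : C -> C) (z : C) : C :=
  ((partial_x f z - Ci * partial_y f z) / 2)%C.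

(* f = h + conj g belongs to the class H, with
     h(z) = z + sum_(k >= 2) a_k z^k   and   g(z) = sum_(k >= 1) b_k z^k.
   The coefficient sequences are indexed from 0, whence the conditions on
   a 0, a 1 and b 0.  Harmonicity of f is automatic for such a sum. *)
Record class_H (f h g : C -> C) (a b : nat -> C) : Prop := {
  H_analytic_h : analytic_in_disk h;
  H_analytic_g : analytic_in_disk g;
  H_decomp : forall z : C, unit_disk z -> f z = (h z + Cconj (g z))%C;
  H_value0 : f (RtoC 0) = RtoC 0;
  H_dz0 : (wirtinger_dz f (RtoC 0) - 1)%C = RtoC 0;
  H_a0 : a 0%nat = RtoC 0;
  H_a1 : a 1%nat = RtoC 1;
  H_b0 : b 0%nat = RtoC 0;
  H_series_h : forall z : C, unit_disk z ->
    @is_pseries C_AbsRing C_NormedModule a z (h z);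
  H_series_g : forall z : C, unit_disk z ->
    @is_pseries C_AbsRing C_NormedModule b z (g z)
}.

(* Division in C is total (x / 0 = 0), so the fact that z h''(z) / h'(z) is
   defined on the whole disk is recorded as F_nonvanishing; a zero of h' would
   be a pole of this quotient, since h'(0) = 1. *)
Record class_F (alpha : R) (lam : C) (f h g : C -> C) (a b : nat -> C) : Prop := {
  F_class_H : class_H f h g a b;
  F_nonvanishing : forall z : C, unit_disk z -> C_derive h z <> RtoC 0;
  F_real_part : forall z : C, unit_disk z ->
    Re (1 + z * C_derive (C_derive h) z / C_derive h z)%C < alpha;
  F_dilatation : forall z : C, unit_disk z ->
    C_derive g z = (lam * z * C_derive h z)%C
}.

(* Main.v *)
Require Import Defs.
From Stdlib Require Import Reals Lra Lia ClassicalEpsilon.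
From Coquelicot Require Import Coquelicot.
Local Open Scope R_scope.

(** Comparing coefficients in g' = lam z h' gives b_2 = lam / 2 and
    b_3 = 2 a_2 lam / 3, so b_3 - delta b_2^2 = 2 a_2 lam / 3 - delta lam^2 / 4
    and the inequality amounts to |a_2| <= c with c = alpha - 1
    ([second_coefficient_bound]).

    That estimate is a Schwarz lemma.  The hypothesis says that q = z h'' / h'
    satisfies Re q < c, hence |q| < |2c - q|.  The function
    phi = h'' / (2c h' - z h'') is therefore analytic with |z phi(z)| < 1 on
    the disk, and phi(0) = a_2 / c.  Averaging phi over the circle |z| = r
    gives |phi(0)| <= 1 / r, and r tends to 1.  The mean value property comes
    from differentiating the circle integral in r: the derivative of the
    integrand in r is, up to the factor r, a derivative in the angle, so it
    integrates to 0 over a period ([circle_mean], [schwarz_at_0]).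

    For sharpness, h' must be the extremal of that Schwarz lemma,
    h'(z) = (1 - u z)^beta with beta = 2 (alpha - 1) and |u| = 1.  It is taken
    as a power series whose coefficients c_n u^n obey
    (n+1) c_(n+1) = (n - beta) c_n; this recursion is the differential equation
    (1 - u z) h'' = - beta u h', from which
    Re (1 + z h'' / h') < 1 + beta / 2 = alpha follows
    ([rotated_binomial_real_part]).  Since 0 < beta <= 1 (this is where
    alpha <= 3/2 enters), all c_n with n >= 1 are nonpositive and the sum of
    their moduli is at most 1, so h' has no zero
    ([rotated_binomial_nonzero]).  Here 2 a_2 = - beta u, and u is chosen to give
    the two terms of b_3 - delta b_2^2 the same argument
    ([exists_rotation_aligning]).

    Derivatives of h and g of every order exist because a power series may be
    differentiated term by term ([sums_on_disk_cderiv]); the quotient phi is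
    then handled by the rules of differentiation, with no expansion of its own. *)

(** * Complex derivatives *)

(** In [is_derive] the variable carries the neighbourhoods given by the modulus
    and the values those of the product R * R; stating the derivative with
    epsilon and delta avoids translating between the two. *)
Definition cderiv (f : C -> C) (z l : C) : Prop :=
  forall eps : R, 0 < eps -> exists delta : R, 0 < delta /\
    forall w : C, Cmod (w - z) < delta ->
      Cmod (f w - f z - l * (w - z)) <= eps * Cmod (w - z).

Definition ccont (f : C -> C) (z : C) : Prop :=
  forall eps : R, 0 < eps -> exists delta : R, 0 < delta /\
    forall w : C, Cmod (w - z) < delta -> Cmod (f w - f z) < eps.

Lemma cderiv_is_derive (f : C -> C) (z l : C) :
  cderiv f z l -> @is_derive C_AbsRing C_NormedModule f z l.
Proof.
intros H; split; [apply is_linear_scal_l|].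
intros x Hx.
assert (x = z) as ->.
{ symmetry. exact (@is_filter_lim_locally_unique C_AbsRing (AbsRing_NormedModule C_AbsRing) z x Hx). }
intros eps.
destruct (H eps (cond_pos eps)) as [d [Hd Hw]].
exists (mkposreal d Hd); intros w Hball.
change (Cmod (f w - f z - (w - z) * l) <= eps * Cmod (w - z)).
rewrite (Cmult_comm (w - z)); apply Hw, Hball.
Qed.

Lemma cderiv_C_derive (f : C -> C) (z l : C) : cderiv f z l -> C_derive f z = l.
Proof. intros H; apply is_C_derive_unique, cderiv_is_derive, H. Qed.

Lemma cderiv_cont (f : C -> C) (z l : C) : cderiv f z l -> ccont f z.
Proof.
intros H eps Heps.
destruct (H 1 Rlt_0_1) as [d [Hd Hw]].
assert (HK : 0 < 1 + Cmod l) by (pose proof (Cmod_ge_0 l); lra).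
exists (Rmin d (eps / (1 + Cmod l))); split.
{ apply Rmin_pos; [exact Hd | apply Rdiv_lt_0_compat; lra]. }
intros w Hlt.
assert (Hlt1 := Rlt_le_trans _ _ _ Hlt (Rmin_l _ _)).
assert (Hlt2 := Rlt_le_trans _ _ _ Hlt (Rmin_r _ _)).
specialize (Hw w Hlt1).
replace (f w - f z)%C with ((f w - f z - l * (w - z)) + l * (w - z))%C by ring.
eapply Rle_lt_trans; [apply Cmod_triangle|].
rewrite Cmod_mult.
apply Rle_lt_trans with ((1 + Cmod l) * Cmod (w - z)); [lra|].
apply (Rmult_lt_compat_l _ _ _ HK) in Hlt2.
replace ((1 + Cmod l) * (eps / (1 + Cmod l))) with eps in Hlt2 by (field; lra).
exact Hlt2.
Qed.

Lemma cderiv_id (z : C) : cderiv (fun w => w) z 1.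
Proof.
intros eps Heps; exists 1; split; [lra|]; intros w _.
replace (w - z - 1 * (w - z))%C with (RtoC 0) by ring.
rewrite Cmod_0; apply Rmult_le_pos; [lra | apply Cmod_ge_0].
Qed.

Lemma cderiv_scal (k : C) (f : C -> C) (z l : C) :
  cderiv f z l -> cderiv (fun w => k * f w)%C z (k * l).
Proof.
intros H eps Heps.
assert (HK : 0 < 1 + Cmod k) by (pose proof (Cmod_ge_0 k); lra).
destruct (H (eps / (1 + Cmod k))) as [d [Hd Hw]]; [apply Rdiv_lt_0_compat; lra|].
exists d; split; [exact Hd|]; intros w Hlt; specialize (Hw w Hlt).
replace (k * f w - k * f z - k * l * (w - z))%C
  with (k * (f w - f z - l * (w - z)))%C by ring.
rewrite Cmod_mult.
apply Rle_trans with ((1 + Cmod k) * (eps / (1 + Cmod k) * Cmod (w - z))).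
- apply Rmult_le_compat; try apply Cmod_ge_0; lra.
- right; field; lra.
Qed.

Lemma cderiv_plus (f g : C -> C) (z l m : C) :
  cderiv f z l -> cderiv g z m -> cderiv (fun w => f w + g w)%C z (l + m).
Proof.
intros Hf Hg eps Heps.
destruct (Hf (eps / 2)) as [d1 [Hd1 H1]]; [lra|].
destruct (Hg (eps / 2)) as [d2 [Hd2 H2]]; [lra|].
exists (Rmin d1 d2); split; [now apply Rmin_pos|]; intros w Hlt.
specialize (H1 w (Rlt_le_trans _ _ _ Hlt (Rmin_l _ _))).
specialize (H2 w (Rlt_le_trans _ _ _ Hlt (Rmin_r _ _))).
replace (f w + g w - (f z + g z) - (l + m) * (w - z))%C
  with ((f w - f z - l * (w - z)) + (g w - g z - m * (w - z)))%C by ring.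
eapply Rle_trans; [apply Cmod_triangle|]; lra.
Qed.

Lemma cderiv_minus (f g : C -> C) (z l m : C) :
  cderiv f z l -> cderiv g z m -> cderiv (fun w => f w - g w)%C z (l - m).
Proof.
intros Hf Hg eps Heps.
destruct (cderiv_plus _ _ _ _ _ Hf (cderiv_scal (-1)%C _ _ _ Hg) eps Heps) as [d [Hd H]].
exists d; split; [exact Hd|]; intros w Hw; specialize (H w Hw).
replace (f w - g w - (f z - g z) - (l - m) * (w - z))%C
  with (f w + -1 * g w - (f z + -1 * g z) - (l + -1 * m) * (w - z))%C by ring.
exact H.
Qed.

Lemma cderiv_mult (f g : C -> C) (z l m : C) :
  cderiv f z l -> cderiv g z m ->
  cderiv (fun w => f w * g w)%C z (l * g z + f z * m).
Proof.
intros Hf Hg eps Heps.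
pose proof (Cmod_ge_0 (f z)) as Pf; pose proof (Cmod_ge_0 (g z)) as Pg.
pose proof (Cmod_ge_0 l) as Pl.
set (K := 1 + Cmod (f z) + Cmod (g z) + Cmod l).
assert (HK : 0 < K) by (unfold K; lra).
assert (He : 0 < eps / K) by (apply Rdiv_lt_0_compat; lra).
destruct (Hf (eps / K) He) as [d1 [Hd1 H1]].
destruct (Hg (eps / K) He) as [d2 [Hd2 H2]].
destruct (cderiv_cont _ _ _ Hg (Rmin 1 (eps / K))) as [d3 [Hd3 H3]].
{ apply Rmin_pos; lra. }
exists (Rmin d1 (Rmin d2 d3)); split; [repeat apply Rmin_pos; lra|]; intros w Hlt.
assert (L1 := Rlt_le_trans _ _ _ Hlt (Rmin_l _ _)).
assert (L23 := Rlt_le_trans _ _ _ Hlt (Rmin_r _ _)).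
specialize (H1 w L1).
specialize (H2 w (Rlt_le_trans _ _ _ L23 (Rmin_l _ _))).
specialize (H3 w (Rlt_le_trans _ _ _ L23 (Rmin_r _ _))).
assert (H3a := Rlt_le_trans _ _ _ H3 (Rmin_l _ _)).
assert (H3b := Rlt_le_trans _ _ _ H3 (Rmin_r _ _)).
replace (f w * g w - f z * g z - (l * g z + f z * m) * (w - z))%C with
  ((f w - f z - l * (w - z)) * (g w - g z) + ((f w - f z - l * (w - z)) * g z
   + (l * (w - z) * (g w - g z) + f z * (g w - g z - m * (w - z)))))%C by ring.
set (x := Cmod (w - z)) in *.
assert (Px : 0 <= x) by apply Cmod_ge_0.
pose proof (Cmod_ge_0 (f w - f z - l * (w - z))) as P1.
pose proof (Cmod_ge_0 (g w - g z)) as P3.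
pose proof (Cmod_ge_0 (g w - g z - m * (w - z))) as P2.
eapply Rle_trans; [apply Cmod_triangle|].
eapply Rle_trans; [apply Rplus_le_compat_l, Cmod_triangle|].
eapply Rle_trans; [apply Rplus_le_compat_l, Rplus_le_compat_l, Cmod_triangle|].
rewrite !Cmod_mult; fold x.
apply Rle_trans with (eps / K * x * 1 + (eps / K * x * Cmod (g z)
  + (Cmod l * x * (eps / K) + Cmod (f z) * (eps / K * x)))).
- repeat apply Rplus_le_compat; repeat apply Rmult_le_compat; try lra; auto.
  now apply Rmult_le_pos.
- right; unfold K; field; fold K; lra.
Qed.

Lemma cderiv_inv (f : C -> C) (z l : C) :
  f z <> RtoC 0 -> cderiv f z l -> cderiv (fun w => / f w)%C z (- l / (f z * f z)).
Proof.
intros Hnz Hf eps Heps.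
assert (Pm : 0 < Cmod (f z)) by now apply Cmod_gt_0.
pose proof (Cmod_ge_0 l) as Pl.
set (m := Cmod (f z)) in *.
(* Near z one has |f w| >= m/2, and then
   1/f w - 1/f z + l (w-z)/f(z)^2
   = -(f w - f z - l (w-z))/(f z f w) + l (w-z)(f w - f z)/(f(z)^2 f w). *)
set (e := eps * (m * m * m) / (2 * m + 2 * Cmod l)).
assert (Hden : 0 < 2 * m + 2 * Cmod l) by lra.
assert (He : 0 < e).
{ apply Rdiv_lt_0_compat; [|lra]; repeat apply Rmult_lt_0_compat; lra. }
destruct (Hf e He) as [d1 [Hd1 H1]].
destruct (cderiv_cont _ _ _ Hf (Rmin (m / 2) e)) as [d2 [Hd2 H2]].
{ apply Rmin_pos; lra. }
exists (Rmin d1 d2); split; [now apply Rmin_pos|]; intros w Hlt.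
specialize (H1 w (Rlt_le_trans _ _ _ Hlt (Rmin_l _ _))).
specialize (H2 w (Rlt_le_trans _ _ _ Hlt (Rmin_r _ _))).
assert (H2a := Rlt_le_trans _ _ _ H2 (Rmin_l _ _)).
assert (H2b := Rlt_le_trans _ _ _ H2 (Rmin_r _ _)).
assert (Hfw : m / 2 < Cmod (f w)).
{ assert (T : m <= Cmod (f w) + Cmod (f w - f z)).
  { unfold m; replace (f z) with (f w + - (f w - f z))%C at 1 by ring.
    eapply Rle_trans; [apply Cmod_triangle|]; rewrite Cmod_opp; lra. }
  lra. }
assert (Hwnz : f w <> RtoC 0) by (apply Cmod_gt_0; lra).
replace (/ f w - / f z - - l / (f z * f z) * (w - z))%C with
  ((- (f w - f z - l * (w - z)) * f z + l * (w - z) * (f w - f z)) *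
    / (f z * f z * f w))%C by (field; auto).
assert (Hnz3 : (f z * f z * f w)%C <> 0) by (repeat apply Cmult_neq_0; auto).
rewrite Cmod_mult, Cmod_inv, !Cmod_mult by exact Hnz3; fold m.
set (x := Cmod (w - z)) in *.
assert (Px : 0 <= x) by apply Cmod_ge_0.
assert (Hnum : Cmod (- (f w - f z - l * (w - z)) * f z + l * (w - z) * (f w - f z))
   <= e * x * m + Cmod l * x * e).
{ eapply Rle_trans; [apply Cmod_triangle|].
  rewrite !Cmod_mult, Cmod_opp; fold m; fold x.
  pose proof (Cmod_ge_0 (f w - f z)).
  apply Rplus_le_compat; apply Rmult_le_compat; try lra; try apply Cmod_ge_0.
  now apply Rmult_le_pos. }
apply Rle_trans with ((e * x * m + Cmod l * x * e) * / (m * m * (m / 2))).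
- apply Rmult_le_compat; [apply Cmod_ge_0 | | exact Hnum |].
  + apply Rlt_le, Rinv_0_lt_compat; repeat apply Rmult_lt_0_compat; lra.
  + apply Rinv_le_contravar; [repeat apply Rmult_lt_0_compat; lra|].
    apply Rmult_le_compat_l; [apply Rmult_le_pos; lra | lra].
- right; unfold e; field; lra.
Qed.

Lemma cderiv_div (f g : C -> C) (z l m : C) :
  g z <> RtoC 0 -> cderiv f z l -> cderiv g z m ->
  cderiv (fun w => f w / g w)%C z ((l * g z - f z * m) / (g z * g z)).
Proof.
intros Hnz Hf Hg.
replace ((l * g z - f z * m) / (g z * g z))%C
  with (l * / g z + f z * (- m / (g z * g z)))%C by (field; exact Hnz).
apply (cderiv_mult f (fun w => / g w)%C); [exact Hf | now apply cderiv_inv].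
Qed.

(** * Derivatives along real curves *)

Lemma is_derive_eps (f : R -> R) (t l : R) :
  is_derive f t l <->
  forall eps : R, 0 < eps -> exists delta : R, 0 < delta /\
    forall s : R, Rabs (s - t) < delta ->
      Rabs (f s - f t - l * (s - t)) <= eps * Rabs (s - t).
Proof.
split.
- intros [_ H] eps Heps.
  destruct (H t (fun P HP => HP) (mkposreal eps Heps)) as [d Hd].
  exists d; split; [apply cond_pos|]; intros s Hs; specialize (Hd s Hs).
  rewrite Rmult_comm with (r1 := l); exact Hd.
- intros H; split; [apply is_linear_scal_l|]; intros x Hx.
  rewrite <- (is_filter_lim_locally_unique _ _ Hx); clear x Hx; intros eps.
  destruct (H eps (cond_pos eps)) as [d [Hd Hs]].
  exists (mkposreal d Hd); intros s Hball; specialize (Hs s Hball).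
  rewrite Rmult_comm with (r1 := l) in Hs; exact Hs.
Qed.

Lemma im_le_Cmod (c : C) : Rabs (Im c) <= Cmod c.
Proof. eapply Rle_trans; [apply Rmax_r | apply Rmax_Cmod]. Qed.

Lemma Cmod_le_abs (x y : R) : Cmod (x, y) <= Rabs x + Rabs y.
Proof.
replace (x, y) with (RtoC x + Ci * RtoC y)%C
  by (apply injective_projections; simpl; ring).
eapply Rle_trans; [apply Cmod_triangle|].
rewrite Cmod_mult, Cmod_Ci, !Cmod_R; lra.
Qed.

(** The chain rule for an analytic function along a real curve, the only link
    between complex and real derivatives: it serves for radii, for circles and
    for the two partial derivatives in the Wirtinger operator. *)
Lemma cderiv_curve (f : C -> C) (x y : R -> R) (t dx dy : R) (l : C) :
  cderiv f (x t, y t) l -> is_derive x t dx -> is_derive y t dy ->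
  is_derive (fun s : R => Re (f (x s, y s))) t (Re (l * (dx, dy))%C) /\
  is_derive (fun s : R => Im (f (x s, y s))) t (Im (l * (dx, dy))%C).
Proof.
intros Hf Hx Hy.
rewrite is_derive_eps in Hx, Hy.
set (v := (dx, dy) : C).
assert (Pv := Cmod_ge_0 v); assert (Pl := Cmod_ge_0 l).
assert (H : forall eps : R, 0 < eps -> exists delta : R, 0 < delta /\
    forall s : R, Rabs (s - t) < delta ->
      Cmod (f (x s, y s) - f (x t, y t) - l * v * RtoC (s - t)) <= eps * Rabs (s - t)).
{ intros eps Heps.
  set (K := Cmod v + 2).
  assert (HK : 0 < K) by (unfold K; lra).
  destruct (Hf (eps / 2 / K)) as [d [Hd H]]; [repeat apply Rdiv_lt_0_compat; lra|].
  set (e := Rmin 1 (eps / 4 / (1 + Cmod l))).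
  assert (He : 0 < e).
  { apply Rmin_pos; [lra|]; repeat apply Rdiv_lt_0_compat; lra. }
  assert (He1 : e <= 1) by apply Rmin_l.
  assert (He2 : e * (1 + Cmod l) <= eps / 4).
  { apply Rle_trans with (eps / 4 / (1 + Cmod l) * (1 + Cmod l)).
    - apply Rmult_le_compat_r; [lra | apply Rmin_r].
    - right; field; lra. }
  destruct (Hx e He) as [d1 [Hd1 H1]]; destruct (Hy e He) as [d2 [Hd2 H2]].
  exists (Rmin (d / K) (Rmin d1 d2)); split.
  { repeat apply Rmin_pos; try lra; now apply Rdiv_lt_0_compat. }
  intros s Hs.
  assert (L1 := Rlt_le_trans _ _ _ Hs (Rmin_l _ _)).
  assert (L23 := Rlt_le_trans _ _ _ Hs (Rmin_r _ _)).
  specialize (H1 s (Rlt_le_trans _ _ _ L23 (Rmin_l _ _))).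
  specialize (H2 s (Rlt_le_trans _ _ _ L23 (Rmin_r _ _))).
  set (a := Rabs (s - t)) in *.
  assert (Pa : 0 <= a) by apply Rabs_pos.
  set (rho := ((x s, y s) - (x t, y t) - v * RtoC (s - t))%C).
  assert (Hrho : Cmod rho <= 2 * e * a).
  { assert (E : rho = (x s - x t - dx * (s - t), y s - y t - dy * (s - t)))
      by (apply injective_projections; unfold rho, v; simpl; ring).
    rewrite E; eapply Rle_trans; [apply Cmod_le_abs|]; lra. }
  assert (Hg : Cmod ((x s, y s) - (x t, y t)) <= K * a).
  { replace ((x s, y s) - (x t, y t))%C with (rho + v * RtoC (s - t))%C
      by (unfold rho; ring).
    eapply Rle_trans; [apply Cmod_triangle|].
    rewrite Cmod_mult, Cmod_R; fold a; unfold K.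
    assert (e * a <= 1 * a) by (apply Rmult_le_compat_r; lra).
    lra. }
  assert (Hgd : Cmod ((x s, y s) - (x t, y t)) < d).
  { eapply Rle_lt_trans; [exact Hg|].
    apply (Rmult_lt_compat_l _ _ _ HK) in L1.
    replace (K * (d / K)) with d in L1 by (field; lra); exact L1. }
  specialize (H _ Hgd).
  replace (f (x s, y s) - f (x t, y t) - l * v * RtoC (s - t))%C with
    ((f (x s, y s) - f (x t, y t) - l * ((x s, y s) - (x t, y t))) + l * rho)%C
    by (unfold rho; ring).
  eapply Rle_trans; [apply Cmod_triangle|].
  rewrite Cmod_mult.
  apply Rle_trans with (eps / 2 / K * (K * a) + (1 + Cmod l) * (2 * e * a)).
  - apply Rplus_le_compat.
    + eapply Rle_trans; [exact H|].
      apply Rmult_le_compat_l; [|exact Hg].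
      apply Rlt_le; repeat apply Rdiv_lt_0_compat; lra.
    + apply Rmult_le_compat; try apply Cmod_ge_0; lra.
  - assert (e * (1 + Cmod l) * a <= eps / 4 * a) by (apply Rmult_le_compat_r; lra).
    replace (eps / 2 / K * (K * a)) with (eps / 2 * a) by (field; lra).
    lra. }
split; rewrite is_derive_eps; intros eps Heps; destruct (H eps Heps) as [d [Hd Hs]];
  exists d; (split; [exact Hd|]); intros s Hst; specialize (Hs s Hst);
  (eapply Rle_trans; [|exact Hs]).
- refine (Rle_trans _ _ _ (Req_le _ _ _) (re_le_Cmod _)); f_equal.
  unfold v, Re; simpl; ring.
- refine (Rle_trans _ _ _ (Req_le _ _ _) (im_le_Cmod _)); f_equal.
  unfold v, Im; simpl; ring.
Qed.

(** * Power series on the unit disk *)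

Notation cpseries := (@is_pseries C_AbsRing C_NormedModule).
Notation cseries := (@is_series C_AbsRing C_NormedModule).

Definition sums_on_disk (a : nat -> C) (f : C -> C) : Prop :=
  forall z : C, unit_disk z -> cpseries a z (f z).

Definition dcoef (a : nat -> C) (n : nat) : C := (RtoC (INR (S n)) * a (S n))%C.

(** Passing to the real series of moduli gives access to the theory of the
    radius of convergence, in particular its invariance under termwise
    differentiation. *)
Definition conv_disk (a : nat -> C) : Prop :=
  Rbar_le 1 (CV_radius (fun n => Cmod (a n))).

Lemma is_pseries_C (a : nat -> C) (z l : C) :
  cpseries a z l <-> cseries (fun n => a n * z ^ n)%C l.
Proof.
assert (E : forall n, @scal C_AbsRing C_NormedModule (pow_n (K := C_AbsRing) z n) (a n) = (a n * z ^ n)%C).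
{ intros n; rewrite (Cmult_comm (a n)).
  reflexivity. }
split; apply is_series_ext; intros n; [|symmetry]; apply E.
Qed.

Lemma cseries_unique (u : nat -> C) (l m : C) : cseries u l -> cseries u m -> l = m.
Proof. intros Hl Hm; exact (filterlim_locally_unique _ _ _ Hl Hm). Qed.

Lemma cseries_ext (u v : nat -> C) (l m : C) :
  (forall n, u n = v n) -> l = m -> cseries u l -> cseries v m.
Proof. intros H <-; now apply is_series_ext. Qed.

Lemma cseries_tail (u : nat -> C) (l : C) :
  u 0%nat = RtoC 0 -> cseries u l -> cseries (fun n => u (S n)) l.
Proof.
intros H0 H; apply is_series_incr_1; rewrite H0.
exact (eq_ind_r (fun m => cseries u m) H (Cplus_0_r l)).
Qed.

Lemma cseries_minus (u v : nat -> C) (l m : C) :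
  cseries u l -> cseries v m -> cseries (fun n => u n - v n)%C (l - m)%C.
Proof. exact (is_series_minus (V := C_NormedModule) u v l m). Qed.

Lemma cseries_scal (k : C) (u : nat -> C) (l : C) :
  cseries u l -> cseries (fun n => k * u n)%C (k * l)%C.
Proof. exact (is_series_scal (V := C_NormedModule) k u l). Qed.

(** The bound is on partial sums, so that absolute convergence need not be
    known beforehand. *)
Lemma cseries_bound (u : nat -> C) (l : C) (M : R) :
  cseries u l -> (forall n, sum_n (fun k => Cmod (u k)) n <= M) -> Cmod l <= M.
Proof.
intros Hu HM.
assert (Hlim : is_lim_seq (fun n => Cmod (@sum_n C_AbelianMonoid u n)) (Cmod l)).
{ exact (filterlim_comp _ _ _ _ _ _ _ _ Hu (@filterlim_norm C_AbsRing C_NormedModule l)). }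
refine (is_lim_seq_le _ _ (Finite _) (Finite _) _ Hlim (is_lim_seq_const M)).
intros n; eapply Rle_trans; [|apply (HM n)].
induction n as [|n IH].
- rewrite !sum_O; lra.
- rewrite !sum_Sn; eapply Rle_trans; [apply Cmod_triangle|].
  apply Rplus_le_compat_r; exact IH.
Qed.

Lemma cseries_bound_Series (u : nat -> C) (l : C) (v : nat -> R) :
  cseries u l -> (forall n, Cmod (u n) <= v n) -> ex_series v -> Cmod l <= Series v.
Proof.
intros Hu Huv Hv; apply (cseries_bound u l _ Hu); intros n.
assert (Hpos : forall k, 0 <= v k)
  by (intros k; eapply Rle_trans; [apply Cmod_ge_0 | apply Huv]).
apply Rle_trans with (sum_n v n).
- induction n as [|n IH]; [rewrite !sum_O; apply Huv|].
  rewrite !sum_Sn; apply Rplus_le_compat; [exact IH | apply Huv].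
- rewrite sum_n_Reals; apply sum_incr; [|exact Hpos].
  apply is_series_Reals, Series_correct, Hv.
Qed.

(** Convergence at a real r < 1 bounds the terms |a_n| r^n, so the radius of
    convergence of the series of moduli is at least r. *)
Lemma conv_disk_of_sum (a : nat -> C) :
  (forall z, unit_disk z -> exists l : C, cpseries a z l) ->
  conv_disk a.
Proof.
intros H; unfold conv_disk.
destruct (CV_radius_bounded (fun n => Cmod (a n))) as [Hub _].
assert (Hr : forall r, 0 <= r < 1 -> Rbar_le r (CV_radius (fun n => Cmod (a n)))).
{ intros r Hr; apply Hub.
  destruct (H (RtoC r)) as [l Hl]; [unfold unit_disk; rewrite Cmod_R, Rabs_pos_eq; lra|].
  apply is_pseries_C in Hl.
  destruct (@filterlim_bounded C_AbsRing C_NormedModule _ (ex_intro _ l Hl)) as [M HM].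
  assert (HM0 : forall n, Cmod (@sum_n C_AbelianMonoid (fun k => a k * RtoC r ^ k)%C n) <= M)
    by exact HM.
  assert (PM : 0 <= M) by (eapply Rle_trans; [apply Cmod_ge_0 | apply (HM0 0%nat)]).
  exists (2 * M); intros n.
  rewrite Rabs_pos_eq by (apply Rmult_le_pos; [apply Cmod_ge_0 | apply pow_le; lra]).
  replace (Cmod (a n) * r ^ n) with (Cmod (a n * RtoC r ^ n))
    by (rewrite Cmod_mult, Cmod_pow, Cmod_R, (Rabs_pos_eq r); lra).
  destruct n as [|n].
  - specialize (HM0 0%nat); rewrite sum_O in HM0; lra.
  - pose proof (HM0 n) as H1; pose proof (HM0 (S n)) as H2.
    rewrite sum_Sn in H2; change plus with Cplus in H2.
    set (s := sum_n _ n) in *; set (t := (a (S n) * RtoC r ^ S n)%C) in *.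
    replace t with ((s + t) + - s)%C by ring.
    eapply Rle_trans; [apply Cmod_triangle|]; rewrite Cmod_opp; lra. }
pose proof (CV_radius_ge_0 (fun n => Cmod (a n))) as H0.
destruct (CV_radius (fun n => Cmod (a n))) as [x| |]; simpl in *; auto.
destruct (Rle_lt_dec 1 x) as [Hx|Hx]; [exact Hx|].
specialize (Hr ((1 + x) / 2)); lra.
Qed.

Lemma conv_disk_bounded (a : nat -> C) (M : R) :
  (forall n, Cmod (a n) <= M) -> conv_disk a.
Proof.
intros H; destruct (CV_radius_bounded (fun n => Cmod (a n))) as [Hub _].
apply Hub; exists M; intros n.
rewrite pow1, Rmult_1_r, Rabs_pos_eq by apply Cmod_ge_0; apply H.
Qed.

Lemma conv_disk_abs (a : nat -> C) (r : R) :
  conv_disk a -> 0 <= r < 1 -> ex_series (fun n => Cmod (a n) * r ^ n).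
Proof.
intros H Hr.
eapply ex_series_ext; [|apply (CV_disk_inside (fun n => Cmod (a n)) r)].
- intros n; apply Rabs_pos_eq, Rmult_le_pos; [apply Cmod_ge_0 | apply pow_le; lra].
- eapply Rbar_lt_le_trans; [|exact H]; simpl; rewrite Rabs_pos_eq; lra.
Qed.

Lemma conv_disk_pseries (a : nat -> C) (z : C) :
  conv_disk a -> unit_disk z -> exists l : C, cpseries a z l.
Proof.
intros H Hz.
destruct (@ex_series_le C_AbsRing C_CompleteNormedModule (fun n => a n * z ^ n)%C
  (fun n => Cmod (a n) * Cmod z ^ n)) as [l Hl].
- intros n; right.
  change (Cmod (a n * z ^ n) = Cmod (a n) * Cmod z ^ n); now rewrite Cmod_mult, Cmod_pow.
- apply conv_disk_abs; [exact H | split; [apply Cmod_ge_0 | exact Hz]].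
- exists l; apply is_pseries_C, Hl.
Qed.

Lemma Cmod_dcoef (a : nat -> C) (n : nat) :
  Cmod (dcoef a n) = PS_derive (fun k => Cmod (a k)) n.
Proof.
unfold dcoef, PS_derive; rewrite Cmod_mult, Cmod_R, Rabs_pos_eq; auto using pos_INR.
Qed.

Lemma conv_disk_dcoef (a : nat -> C) : conv_disk a -> conv_disk (dcoef a).
Proof.
unfold conv_disk; intros H.
rewrite (CV_radius_ext _ _ (Cmod_dcoef a)), CV_radius_derive; exact H.
Qed.

(** With E_n = w^n - z^n - n z^(n-1) (w - z) one has
    E_(n+1) = w E_n + n z^(n-1) (w - z)^2; the bound follows by induction.  Its
    constants are those of the second termwise derivative at rho. *)
Lemma pow_second_order (z w : C) (rho : R) (n : nat) :
  Cmod z <= rho -> Cmod w <= rho ->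
  Cmod (w ^ S (S n) - z ^ S (S n) - RtoC (INR (S (S n))) * z ^ S n * (w - z))
    <= INR (S n) * INR (S (S n)) * rho ^ n * Cmod (w - z) ^ 2.
Proof.
intros Hz Hw.
assert (Pr : 0 <= rho) by (eapply Rle_trans; [apply Cmod_ge_0 | exact Hz]).
induction n as [|n IH].
- replace (w ^ 2 - z ^ 2 - RtoC (INR 2) * z ^ 1 * (w - z))%C with ((w - z) ^ 2)%C
    by (simpl INR; rewrite RtoC_plus; ring).
  rewrite Cmod_pow; simpl INR; pose proof (pow2_ge_0 (Cmod (w - z))); simpl (rho ^ 0); lra.
- set (E := (w ^ S (S n) - z ^ S (S n) - RtoC (INR (S (S n))) * z ^ S n * (w - z))%C) in *.
  replace (w ^ S (S (S n)) - z ^ S (S (S n)) - RtoC (INR (S (S (S n)))) * z ^ S (S n) * (w - z))%C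
    with (w * E + RtoC (INR (S (S n))) * z ^ S n * (w - z) ^ 2)%C.
  2:{ unfold E; rewrite (S_INR (S (S n))), RtoC_plus, !Cpow_S; ring. }
  eapply Rle_trans; [apply Cmod_triangle|].
  rewrite !Cmod_mult, !Cmod_pow, Cmod_R, (Rabs_pos_eq (INR _)) by apply pos_INR.
  set (x := Cmod (w - z) ^ 2) in *.
  assert (Px : 0 <= x) by apply pow2_ge_0.
  assert (Pz : Cmod z ^ S n <= rho ^ S n) by (apply pow_incr; split; [apply Cmod_ge_0 | exact Hz]).
  apply Rle_trans with (rho * (INR (S n) * INR (S (S n)) * rho ^ n * x)
     + INR (S (S n)) * rho ^ S n * x).
  + apply Rplus_le_compat.
    * apply Rmult_le_compat; auto using Cmod_ge_0.
    * apply Rmult_le_compat_r; [exact Px|]; apply Rmult_le_compat_l; [apply pos_INR | exact Pz].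
  + assert (0 <= INR (S (S n)) * rho ^ S n * x).
    { apply Rmult_le_pos; [apply Rmult_le_pos; [apply pos_INR | now apply pow_le]|exact Px]. }
    rewrite (S_INR (S (S n))), (S_INR (S n)) in *; simpl pow in *.
    nra.
Qed.

(** Termwise differentiation.  On a smaller disk |z|, |w| <= rho < 1, summing
    [pow_second_order] bounds the remainder by |w - z|^2 times the sum of the
    moduli of the second termwise derivative at rho, which is finite. *)
Lemma sums_on_disk_cderiv (a : nat -> C) (f : C -> C) :
  sums_on_disk a f -> forall z, unit_disk z ->
  exists l : C, cpseries (dcoef a) z l /\ cderiv f z l.
Proof.
intros Hf z Hz.
assert (Hc : conv_disk a) by (apply conv_disk_of_sum; intros v Hv; exists (f v); auto).
assert (Hc1 := conv_disk_dcoef _ Hc); assert (Hc2 := conv_disk_dcoef _ Hc1).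
destruct (conv_disk_pseries _ _ Hc1 Hz) as [l Hl]; exists l; split; [exact Hl|].
set (rho := (1 + Cmod z) / 2).
assert (Hrho : 0 <= rho < 1 /\ Cmod z < rho).
{ unfold rho; unfold unit_disk in Hz; pose proof (Cmod_ge_0 z); lra. }
destruct Hrho as [Hrho Hzr].
set (B := fun n => Cmod (dcoef (dcoef a) n) * rho ^ n).
assert (HB : ex_series B) by (apply conv_disk_abs; assumption).
assert (Key : forall w, Cmod w <= rho ->
  Cmod (f w - f z - l * (w - z)) <= Rabs (Series B) * Cmod (w - z) ^ 2).
{ intros w Hw.
  assert (Hfw : unit_disk w) by (unfold unit_disk; lra).
  pose proof (proj1 (is_pseries_C _ _ _) (Hf _ Hfw)) as Sw.
  pose proof (proj1 (is_pseries_C _ _ _) (Hf _ Hz)) as Sz.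
  assert (Sl := proj1 (is_pseries_C _ _ _) Hl).
  assert (SE : cseries (fun n => a (S (S n)) * (w ^ S (S n) - z ^ S (S n)
     - RtoC (INR (S (S n))) * z ^ S n * (w - z)))%C (f w - f z - l * (w - z))%C).
  { assert (S1 := cseries_minus _ _ _ _ Sw Sz).
    apply cseries_tail in S1; [|simpl; ring].
    assert (S2 := cseries_minus _ _ _ _ S1 (cseries_scal (w - z)%C _ _ Sl)).
    apply cseries_tail in S2.
    - revert S2; apply cseries_ext; [|ring].
      intros n; unfold dcoef; ring.
    - unfold dcoef; simpl; ring. }
  apply Rle_trans with (Series B * Cmod (w - z) ^ 2).
  2:{ apply Rmult_le_compat_r; [apply pow2_ge_0 | apply Rle_abs]. }
  rewrite <- (is_series_unique _ _ (is_series_scal_r (Cmod (w - z) ^ 2) _ _ (Series_correct _ HB))).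
  refine (cseries_bound_Series _ _ _ SE _ _).
  - intros n; unfold B, dcoef.
    assert (Hp := pow_second_order z w rho n (Rlt_le _ _ Hzr) Hw).
    rewrite !Cmod_mult, !Cmod_R, !(Rabs_pos_eq (INR _)) by apply pos_INR.
    apply (Rmult_le_compat_l (Cmod (a (S (S n)))) _ _ (Cmod_ge_0 _)) in Hp.
    eapply Rle_trans; [exact Hp|]; right; ring.
  - eexists; apply is_series_scal_r, Series_correct, HB. }
intros eps Heps.
assert (PS : 0 <= Rabs (Series B)) by apply Rabs_pos.
exists (Rmin (rho - Cmod z) (eps / (1 + Rabs (Series B)))); split.
{ apply Rmin_pos; [lra | apply Rdiv_lt_0_compat; lra]. }
intros w Hlt.
assert (H1 := Rlt_le_trans _ _ _ Hlt (Rmin_l _ _)).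
assert (H2 := Rlt_le_trans _ _ _ Hlt (Rmin_r _ _)).
eapply Rle_trans; [apply Key|].
- replace w with ((w - z) + z)%C by ring.
  eapply Rle_trans; [apply Cmod_triangle|]; lra.
- pose proof (Cmod_ge_0 (w - z)) as Px.
  apply (Rmult_lt_compat_l (1 + Rabs (Series B))) in H2; [|lra].
  replace ((1 + Rabs (Series B)) * (eps / (1 + Rabs (Series B)))) with eps in H2 by (field; lra).
  simpl pow; rewrite Rmult_1_r, <- Rmult_assoc.
  apply Rmult_le_compat_r; lra.
Qed.

Lemma sums_on_disk_derive (a : nat -> C) (f : C -> C) :
  sums_on_disk a f ->
  (forall z, unit_disk z -> cderiv f z (C_derive f z)) /\
  sums_on_disk (dcoef a) (C_derive f).
Proof.
intros H; split; intros z Hz;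
  destruct (sums_on_disk_cderiv a f H z Hz) as [l [Hl Hd]];
  now rewrite (cderiv_C_derive _ _ _ Hd).
Qed.

Lemma unit_disk_0 : unit_disk 0.
Proof. unfold unit_disk; rewrite Cmod_0; lra. Qed.

Lemma sums_on_disk_at_0 (a : nat -> C) (f : C -> C) : sums_on_disk a f -> f 0 = a 0%nat.
Proof.
intros H; apply (cseries_unique (fun n => a n * 0 ^ n)%C);
  [apply is_pseries_C, H, unit_disk_0 | apply is_pseries_C].
exact (@is_pseries_0 C_AbsRing C_NormedModule a).
Qed.

Lemma sums_on_disk_ext (a b : nat -> C) (f g : C -> C) :
  (forall n, a n = b n) -> (forall z, unit_disk z -> f z = g z) ->
  sums_on_disk a f -> sums_on_disk b g.
Proof.
intros Hab Hfg H z Hz; rewrite <- (Hfg z Hz).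
exact (is_pseries_ext _ _ _ _ Hab (H z Hz)).
Qed.

Lemma sums_on_disk_fun_unique (a : nat -> C) (f g : C -> C) :
  sums_on_disk a f -> sums_on_disk a g -> forall z, unit_disk z -> f z = g z.
Proof.
intros Hf Hg z Hz.
exact (cseries_unique _ _ _ (proj1 (is_pseries_C _ _ _) (Hf z Hz))
  (proj1 (is_pseries_C _ _ _) (Hg z Hz))).
Qed.

Lemma RtoC_neq_0 (x : R) : x <> 0 -> RtoC x <> RtoC 0.
Proof. intros H E; apply H; exact (RtoC_inj _ _ E). Qed.

(** The constant coefficient is the value at 0, and each further one is read
    off from the derivative. *)
Lemma sums_on_disk_coef_unique (a b : nat -> C) (f : C -> C) (n : nat) :
  sums_on_disk a f -> sums_on_disk b f -> a n = b n.
Proof.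
revert a b f; induction n as [|n IH]; intros a b f Ha Hb.
- now rewrite <- (sums_on_disk_at_0 a f), <- (sums_on_disk_at_0 b f).
- assert (E : dcoef a n = dcoef b n).
  { apply (IH _ _ (C_derive f)); now apply sums_on_disk_derive. }
  unfold dcoef in E.
  assert (Hn : RtoC (INR (S n)) <> 0) by (apply RtoC_neq_0, not_0_INR; lia).
  replace (a (S n)) with (/ RtoC (INR (S n)) * (RtoC (INR (S n)) * a (S n)))%C
    by (field; exact Hn).
  rewrite E; field; exact Hn.
Qed.

(** The coefficients of k z f(z), those of f being a. *)
Definition shift_scal (k : C) (a : nat -> C) (n : nat) : C :=
  match n with O => RtoC 0 | S m => (k * a m)%C end.

Lemma sums_on_disk_shift_scal (k : C) (a : nat -> C) (f : C -> C) :
  sums_on_disk a f -> sums_on_disk (shift_scal k a) (fun z => k * z * f z)%C.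
Proof.
intros H z Hz; apply is_pseries_C, is_series_decr_1.
assert (S := cseries_scal (k * z)%C _ _ (proj1 (is_pseries_C _ _ _) (H z Hz))).
revert S; apply cseries_ext; [intros n; simpl; ring|].
change ((k * z * f z)%C = (k * z * f z + - (RtoC 0 * z ^ 0))%C); ring.
Qed.

Lemma sums_on_disk_scal (k : C) (a : nat -> C) (f : C -> C) :
  sums_on_disk a f -> sums_on_disk (fun n => k * a n)%C (fun z => k * f z)%C.
Proof.
intros H z Hz; apply is_pseries_C.
generalize (cseries_scal k _ _ (proj1 (is_pseries_C _ _ _) (H z Hz))).
apply cseries_ext; [intros n; ring | reflexivity].
Qed.

Lemma sums_on_disk_minus (a b : nat -> C) (f g : C -> C) :
  sums_on_disk a f -> sums_on_disk b g ->
  sums_on_disk (fun n => a n - b n)%C (fun z => f z - g z)%C.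
Proof.
intros Ha Hb z Hz; apply is_pseries_C.
generalize (cseries_minus _ _ _ _ (proj1 (is_pseries_C _ _ _) (Ha z Hz))
  (proj1 (is_pseries_C _ _ _) (Hb z Hz))).
apply cseries_ext; [intros n; ring | reflexivity].
Qed.

Lemma conv_disk_sum (a : nat -> C) : conv_disk a -> exists f, sums_on_disk a f.
Proof.
intros H.
exists (fun z => epsilon (inhabits (RtoC 0))
  (fun l : C => cpseries a z l)).
intros z Hz; apply epsilon_spec, conv_disk_pseries; assumption.
Qed.

(** * Mean value over circles and the Schwarz lemma *)

Lemma ccont_2d (psi : C -> C) (X Y : R -> R -> R) (u v : R) :
  ccont psi (X u v, Y u v) -> continuity_2d_pt X u v -> continuity_2d_pt Y u v ->
  continuity_2d_pt (fun s t => Re (psi (X s t, Y s t))) u v /\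
  continuity_2d_pt (fun s t => Im (psi (X s t, Y s t))) u v.
Proof.
intros Hpsi HX HY.
assert (H : forall eps : posreal, locally_2d (fun s t =>
  Cmod (psi (X s t, Y s t) - psi (X u v, Y u v)) < eps) u v).
{ intros eps; destruct (Hpsi eps (cond_pos eps)) as [d [Hd H]].
  assert (Hd2 : 0 < d / 2) by lra.
  destruct (HX (mkposreal _ Hd2)) as [d1 H1]; destruct (HY (mkposreal _ Hd2)) as [d2 H2].
  assert (Hm : 0 < Rmin d1 d2) by (apply Rmin_pos; apply cond_pos).
  exists (mkposreal _ Hm); simpl; intros s t Hs Ht; apply H.
  specialize (H1 s t (Rlt_le_trans _ _ _ Hs (Rmin_l _ _)) (Rlt_le_trans _ _ _ Ht (Rmin_l _ _))).
  specialize (H2 s t (Rlt_le_trans _ _ _ Hs (Rmin_r _ _)) (Rlt_le_trans _ _ _ Ht (Rmin_r _ _))).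
  simpl in H1, H2.
  refine (Rle_lt_trans _ _ _ (Cmod_le_abs (X s t - X u v) (Y s t - Y u v)) _); lra. }
split; intros eps; destruct (H eps) as [d Hd]; exists d; intros s t Hs Ht;
  (eapply Rle_lt_trans; [|exact (Hd s t Hs Ht)]).
- exact (re_le_Cmod (psi (X s t, Y s t) - psi (X u v, Y u v))).
- exact (im_le_Cmod (psi (X s t, Y s t) - psi (X u v, Y u v))).
Qed.

Lemma Cmod_polar (r t : R) : Cmod (r * cos t, r * sin t) = Rabs r.
Proof.
replace (r * cos t, r * sin t) with (RtoC r * (cos t, sin t))%C
  by (apply injective_projections; simpl; ring).
rewrite Cmod_mult, Cmod_R; unfold Cmod; simpl fst; simpl snd.
replace (cos t ^ 2 + sin t ^ 2) with 1 by (rewrite <- (sin2_cos2 t); unfold Rsqr; ring).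
rewrite sqrt_1; lra.
Qed.

(** Negative radii are allowed, so that the circle integral is defined on both
    sides of r = 0. *)
Lemma unit_disk_polar (r t : R) : Rabs r < 1 -> unit_disk (r * cos t, r * sin t).
Proof. intros Hr; unfold unit_disk; now rewrite Cmod_polar. Qed.

Section Circle.

Variables phi psi : C -> C.
Hypothesis phi_deriv : forall z, unit_disk z -> cderiv phi z (psi z).
Hypothesis psi_cont : forall z, unit_disk z -> ccont psi z.

Let F (r t : R) : R := Re (phi (r * cos t, r * sin t)).
Let G (r t : R) : R :=
  Re (psi (r * cos t, r * sin t)) * cos t - Im (psi (r * cos t, r * sin t)) * sin t.

Lemma radial_derivative (r t : R) : Rabs r < 1 -> is_derive (fun u => F u t) r (G r t).
Proof.
intros Hr.
apply (cderiv_curve phi (fun u => u * cos t) (fun u => u * sin t) r (cos t) (sin t)).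
- apply phi_deriv, unit_disk_polar, Hr.
- auto_derive; [exact I | ring].
- auto_derive; [exact I | ring].
Qed.

(** The Cauchy-Riemann equations in polar form: r times the radial derivative
    of the real part is the angular derivative of the imaginary part. *)
Lemma angular_derivative (r t : R) : Rabs r < 1 ->
  ex_derive (fun s => F r s) t /\
  is_derive (fun s => Im (phi (r * cos s, r * sin s))) t (r * G r t).
Proof.
intros Hr.
destruct (cderiv_curve phi (fun s => r * cos s) (fun s => r * sin s) t
  (- r * sin t) (r * cos t) _ (phi_deriv _ (unit_disk_polar r t Hr))) as [H1 H2].
- auto_derive; [exact I | ring].
- auto_derive; [exact I | ring].
- split; [eexists; exact H1|].
  replace (r * G r t) with (Im (Cmult (psi (r * cos t, r * sin t)) (- r * sin t, r * cos t)));
    [exact H2 | unfold G, Re, Im; simpl; ring].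
Qed.

Lemma radial_derivative_continuous_2d (r t : R) : Rabs r < 1 -> continuity_2d_pt G r t.
Proof.
intros Hr.
assert (Hcos : continuity_2d_pt (fun _ s => cos s) r t)
  by (apply (continuity_1d_2d_pt_comp cos (fun _ s => s));
      [apply continuity_cos | apply continuity_2d_pt_id2]).
assert (Hsin : continuity_2d_pt (fun _ s => sin s) r t)
  by (apply (continuity_1d_2d_pt_comp sin (fun _ s => s));
      [apply continuity_sin | apply continuity_2d_pt_id2]).
destruct (ccont_2d psi (fun u s => u * cos s) (fun u s => u * sin s) r t) as [H1 H2].
- apply psi_cont, unit_disk_polar, Hr.
- apply continuity_2d_pt_mult; [apply continuity_2d_pt_id1 | exact Hcos].
- apply continuity_2d_pt_mult; [apply continuity_2d_pt_id1 | exact Hsin].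
- apply continuity_2d_pt_minus; apply continuity_2d_pt_mult; assumption.
Qed.

Lemma radial_derivative_continuous (r t : R) : Rabs r < 1 -> continuous (G r) t.
Proof.
intros Hr; apply continuity_pt_filterlim, continuity_pt_locally; intros eps.
destruct (radial_derivative_continuous_2d r t Hr eps) as [d Hd].
exists d; intros s Hs; apply Hd; [rewrite Rminus_diag, Rabs_R0; apply cond_pos | exact Hs].
Qed.

Lemma locally_small (r : R) : Rabs r < 1 -> locally r (fun u => Rabs u < 1).
Proof.
intros Hr; assert (H : 0 < 1 - Rabs r) by lra.
exists (mkposreal _ H); intros u Hu; change (Rabs (u - r) < 1 - Rabs r) in Hu.
replace u with ((u - r) + r) by ring.
eapply Rle_lt_trans; [apply Rabs_triang|]; lra.
Qed.

Lemma circle_integral_derivative (r : R) : Rabs r < 1 ->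
  is_derive (fun u => RInt (F u) 0 (2 * PI)) r (RInt (G r) 0 (2 * PI)).
Proof.
intros Hr.
replace (RInt (G r) 0 (2 * PI)) with (RInt (fun t => Derive (fun u => F u t) r) 0 (2 * PI))
  by (apply RInt_ext; intros t _; apply is_derive_unique, radial_derivative, Hr).
apply (is_derive_RInt_param F).
- apply (filter_imp _ _ (fun u Hu t _ => ex_intro _ _ (radial_derivative u t Hu))).
  now apply locally_small.
- intros t _; apply continuity_2d_pt_ext_loc with G; [|now apply radial_derivative_continuous_2d].
  destruct (locally_small r Hr) as [d Hd]; exists d; intros u v Hu _.
  symmetry; apply is_derive_unique, radial_derivative, Hd, Hu.
- eapply filter_imp; [|apply (locally_small r Hr)]; intros u Hu.
  apply (ex_RInt_continuous (V := R_CompleteNormedModule)); intros t _.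
  apply (ex_derive_continuous (F u)), angular_derivative, Hu.
Qed.

Lemma radial_derivative_integral (r : R) : Rabs r < 1 -> r <> 0 -> RInt (G r) 0 (2 * PI) = 0.
Proof.
intros Hr Hr0.
assert (H : is_RInt (fun t => r * G r t) 0 (2 * PI)
  (minus (Im (phi (r * cos (2 * PI), r * sin (2 * PI)))) (Im (phi (r * cos 0, r * sin 0))))).
{ apply (is_RInt_derive (V := R_CompleteNormedModule)
    (fun s => Im (phi (r * cos s, r * sin s)))); intros t _.
  - now apply angular_derivative.
  - apply (continuous_scal_r r (G r)), radial_derivative_continuous, Hr. }
rewrite cos_2PI, sin_2PI, cos_0, sin_0, minus_eq_zero in H.
apply (is_RInt_unique (V := R_CompleteNormedModule)) in H.
assert (E := RInt_scal (V := R_CompleteNormedModule) (G r) 0 (2 * PI) r).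
change (ex_RInt (G r) 0 (2 * PI) ->
  RInt (fun t => r * G r t) 0 (2 * PI) = r * RInt (G r) 0 (2 * PI)) in E.
rewrite H in E; change (@zero R_CompleteNormedModule) with 0 in E.
destruct (Rmult_integral r (RInt (G r) 0 (2 * PI))) as [E0|E0]; [|contradiction|exact E0].
symmetry; apply E, (ex_RInt_continuous (V := R_CompleteNormedModule)).
intros t _; now apply radial_derivative_continuous.
Qed.

(** The circle integral does not depend on the radius, and at radius 0 its
    integrand is constant. *)
Lemma circle_mean (r : R) : 0 < r < 1 ->
  RInt (F r) 0 (2 * PI) = 2 * PI * Re (phi 0).
Proof.
intros Hr.
destruct (MVT_gen (fun u => RInt (F u) 0 (2 * PI)) 0 r (fun _ => 0)) as [c [_ Hc]].
- rewrite Rmin_left, Rmax_right by lra; intros x Hx.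
  (* At the centre the polar Cauchy-Riemann equation is void, hence the mean
     value theorem on the open interval and mere continuity at 0. *)
  assert (Hx1 : Rabs x < 1) by (rewrite Rabs_pos_eq; lra).
  assert (D := circle_integral_derivative x Hx1).
  rewrite radial_derivative_integral in D by lra; exact D.
- rewrite Rmin_left, Rmax_right by lra; intros x Hx.
  apply continuity_pt_filterlim, (ex_derive_continuous (fun u => RInt (F u) 0 (2 * PI))).
  eexists; apply circle_integral_derivative; rewrite Rabs_pos_eq; lra.
- assert (E : RInt (F 0) 0 (2 * PI) = 2 * PI * Re (phi 0)).
  { rewrite (RInt_ext _ (fun _ => Re (phi 0))).
    - rewrite RInt_const; unfold scal; simpl; unfold mult; simpl; ring.
    - intros t _; unfold F; now rewrite !Rmult_0_l. }
  lra.
Qed.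

End Circle.

Lemma rotation_to_modulus (z : C) : exists u : C, Cmod u = 1 /\ (u * z)%C = RtoC (Cmod z).
Proof.
destruct (Ceq_dec z 0) as [->|Hz].
- exists 1; rewrite Cmod_1, Cmod_0; split; [reflexivity | ring].
- assert (H : 0 < Cmod z) by now apply Cmod_gt_0.
  exists (RtoC (Cmod z) / z)%C; split; [|field; exact Hz].
  rewrite Cmod_div, Cmod_R, Rabs_pos_eq by (auto; lra); field; lra.
Qed.

(** The Schwarz lemma for z phi(z), reduced to its bound on phi(0).  After a
    rotation phi(0) is real and nonnegative, so only the mean of a real part is
    involved; on the circle |z| = r it is at most 1/r, and r tends to 1. *)
Lemma schwarz_at_0 (phi psi : C -> C) :
  (forall z, unit_disk z -> cderiv phi z (psi z)) ->
  (forall z, unit_disk z -> ccont psi z) ->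
  (forall z, unit_disk z -> Cmod z * Cmod (phi z) <= 1) ->
  Cmod (phi 0) <= 1.
Proof.
intros Hd Hc Hb.
destruct (rotation_to_modulus (phi 0)) as [u [Hu Hu0]].
assert (Hr : forall r, 0 < r < 1 -> r * Cmod (phi 0) <= 1).
{ intros r Hr.
  assert (Hr1 : Rabs r < 1) by (rewrite Rabs_pos_eq; lra).
  assert (Hd' : forall z, unit_disk z -> cderiv (fun w => u * phi w)%C z (u * psi z)%C)
    by (intros z Hz; now apply cderiv_scal, Hd).
  assert (Hc' : forall z, unit_disk z -> ccont (fun w => u * psi w)%C z).
  { intros z Hz eps Heps; destruct (Hc z Hz eps Heps) as [d [Hdp H]].
    exists d; split; [exact Hdp|]; intros w Hw.
    replace (u * psi w - u * psi z)%C with (u * (psi w - psi z))%C by ring.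
    rewrite Cmod_mult, Hu, Rmult_1_l; now apply H. }
  assert (Hm := circle_mean (fun w => u * phi w)%C _ Hd' Hc' r Hr).
  cbv beta in Hm; rewrite Hu0 in Hm.
  assert (Hle : RInt (fun t => Re (Cmult u (phi (r * cos t, r * sin t)))) 0 (2 * PI)
     <= RInt (fun _ => / r) 0 (2 * PI)).
  { pose proof PI_RGT_0; apply RInt_le; [lra | | |].
    - apply (ex_RInt_continuous (V := R_CompleteNormedModule)); intros t _.
      apply (ex_derive_continuous (fun s => Re (Cmult u (phi (r * cos s, r * sin s))))).
      exact (proj1 (angular_derivative _ _ Hd' r t Hr1)).
    - apply ex_RInt_const.
    - intros t _.
      eapply Rle_trans; [apply Rle_abs|]; eapply Rle_trans; [apply re_le_Cmod|].
      rewrite Cmod_mult, Hu, Rmult_1_l.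
      assert (E := Hb _ (unit_disk_polar r t Hr1)).
      rewrite (Cmod_polar r t), (Rabs_pos_eq r) in E by lra.
      apply (Rmult_le_reg_l r); [lra|]; rewrite Rinv_r; lra. }
  rewrite Hm, RInt_const in Hle; unfold scal in Hle; simpl in Hle; unfold mult in Hle; simpl in Hle.
  pose proof PI_RGT_0.
  assert (Cmod (phi 0) <= / r) by (apply (Rmult_le_reg_l (2 * PI)); lra).
  apply Rmult_le_compat_l with (r := r) in H0; [|lra].
  rewrite Rinv_r in H0; lra. }
apply Rnot_lt_le; intros Hlt.
assert (Hinv : / Cmod (phi 0) < 1) by (rewrite <- Rinv_1; apply Rinv_lt_contravar; lra).
assert (0 < / Cmod (phi 0)) by (apply Rinv_0_lt_compat; lra).
specialize (Hr ((1 + / Cmod (phi 0)) / 2)).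
assert (E : (1 + / Cmod (phi 0)) / 2 * Cmod (phi 0) = (Cmod (phi 0) + 1) / 2) by (field; lra).
rewrite E in Hr; lra.
Qed.

(** * The coefficient inequality *)

(** A point with real part less than c is closer to 0 than to the mirror
    image 2c of 0 in the line Re = c. *)
Lemma Re_lt_reflection (q : C) (c : R) :
  0 < c -> Re q < c -> Cmod q < Cmod (2 * RtoC c - q).
Proof.
intros Hc H; destruct q as [x y]; unfold Re in H; simpl in H.
unfold Cmod; apply sqrt_lt_1_alt; split.
- pose proof (pow2_ge_0 x); pose proof (pow2_ge_0 y); simpl fst; simpl snd; lra.
- simpl; ring_simplify; nra.
Qed.

(** The Schwarz lemma applied to phi = h'' / (2c h' - z h''): with
    q = z h'' / h' one has z phi = q / (2c - q), of modulus less than 1, and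
    phi(0) = 2 a_2 / (2c). *)
Lemma second_coefficient_bound (c : R) (a : nat -> C) (h : C -> C) :
  0 < c -> sums_on_disk a h ->  a 1%nat = RtoC 1 ->
  (forall z, unit_disk z -> C_derive h z <> RtoC 0) ->
  (forall z, unit_disk z -> Re (z * C_derive (C_derive h) z / C_derive h z)%C < c) ->
  Cmod (a 2%nat) <= c.
Proof.
intros Hc Hh Ha1 Hnz Hre.
destruct (sums_on_disk_derive _ _ Hh) as [_ Hh1].
destruct (sums_on_disk_derive _ _ Hh1) as [D1 Hh2].
destruct (sums_on_disk_derive _ _ Hh2) as [D2 Hh3].
destruct (sums_on_disk_derive _ _ Hh3) as [D3 _].
set (h1 := C_derive h) in *; set (h2 := C_derive h1) in *; set (h3 := C_derive h2) in *.
set (h4 := C_derive h3) in *.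
set (D := fun z => (2 * RtoC c * h1 z - z * h2 z)%C).
assert (HD : forall z, unit_disk z -> Cmod (z * h2 z) < Cmod (D z)).
{ intros z Hz.
  assert (P : 0 < Cmod (h1 z)) by now apply Cmod_gt_0, Hnz.
  assert (E1 : (z * h2 z)%C = (h1 z * (z * h2 z / h1 z))%C) by (field; now apply Hnz).
  assert (E2 : D z = (h1 z * (2 * RtoC c - z * h2 z / h1 z))%C)
    by (unfold D; field; now apply Hnz).
  rewrite E1, E2, !Cmod_mult.
  apply Rmult_lt_compat_l; [exact P | apply Re_lt_reflection; auto]. }
assert (HDnz : forall z, unit_disk z -> D z <> 0).
{ intros z Hz; apply Cmod_gt_0; eapply Rle_lt_trans; [apply Cmod_ge_0 | now apply HD]. }
set (D' := fun z => (2 * RtoC c * h2 z - (1 * h2 z + z * h3 z))%C).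
assert (DD : forall z, unit_disk z -> cderiv D z (D' z)).
{ intros z Hz; apply cderiv_minus; [now apply cderiv_scal, D1|].
  apply (cderiv_mult (fun w => w)); [apply cderiv_id | now apply D2]. }
assert (Hphi0 : Cmod (h2 0 / D 0) <= 1).
{ apply (schwarz_at_0 (fun z => h2 z / D z)%C
    (fun z => (h3 z * D z - h2 z * D' z) / (D z * D z))%C).
  - intros z Hz; apply cderiv_div; auto.
  - intros z Hz; eapply cderiv_cont, cderiv_div.
    + now apply Cmult_neq_0; apply HDnz.
    + apply cderiv_minus; apply cderiv_mult; auto.
      apply cderiv_minus; [now apply cderiv_scal, D2|].
      apply cderiv_plus; [now apply cderiv_scal, D2|].
      apply (cderiv_mult (fun w => w)); [apply cderiv_id | now apply D3].
    + apply cderiv_mult; auto.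
  - intros z Hz.
    rewrite Cmod_div by auto; specialize (HD z Hz); rewrite Cmod_mult in HD.
    assert (P : 0 < Cmod (D z)) by now apply Cmod_gt_0, HDnz.
    apply (Rmult_le_reg_r (Cmod (D z))); [exact P|].
    replace (Cmod z * (Cmod (h2 z) / Cmod (D z)) * Cmod (D z))
      with (Cmod z * Cmod (h2 z)) by (field; lra).
    lra. }
assert (E2 : h2 0 = (2 * a 2%nat)%C).
{ rewrite (sums_on_disk_at_0 _ _ Hh2); unfold dcoef; simpl INR; rewrite RtoC_plus; ring. }
assert (E1 : D 0 = (2 * RtoC c)%C).
{ unfold D; rewrite (sums_on_disk_at_0 _ _ Hh1); unfold dcoef; rewrite Ha1; simpl INR; ring. }
rewrite E1, E2 in Hphi0.
assert (Hc0 : RtoC c <> 0) by (apply RtoC_neq_0; lra).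
replace (2 * a 2%nat / (2 * RtoC c))%C with (a 2%nat / RtoC c)%C in Hphi0 by (field; auto).
rewrite Cmod_div, Cmod_R, Rabs_pos_eq in Hphi0 by (auto; lra).
apply (Rmult_le_compat_r c) in Hphi0; [|lra].
replace (Cmod (a 2%nat) / c * c) with (Cmod (a 2%nat)) in Hphi0 by (field; lra); lra.
Qed.

Lemma dilatation_coefficients (lam : C) (a b : nat -> C) (h g : C -> C) (n : nat) :
  sums_on_disk a h -> sums_on_disk b g ->
  (forall z, unit_disk z -> C_derive g z = (lam * z * C_derive h z)%C) ->
  dcoef b n = shift_scal lam (dcoef a) n.
Proof.
intros Hh Hg Hdil.
apply sums_on_disk_coef_unique with (C_derive g); [now apply sums_on_disk_derive|].
apply sums_on_disk_ext with (shift_scal lam (dcoef a)) (fun z => lam * z * C_derive h z)%C.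
- reflexivity.
- intros z Hz; now rewrite Hdil.
- now apply sums_on_disk_shift_scal, sums_on_disk_derive.
Qed.

Lemma coanalytic_coefficients (lam : C) (a b : nat -> C) :
  a 1%nat = RtoC 1 -> (forall n, dcoef b n = shift_scal lam (dcoef a) n) ->
  b 2%nat = (lam / 2)%C /\ b 3%nat = (2 * a 2%nat * lam / 3)%C.
Proof.
intros Ha H.
assert (H1 := H 1%nat); assert (H2 := H 2%nat).
unfold dcoef in H1, H2; simpl in H1, H2; rewrite ?RtoC_plus in *; rewrite ?Ha in *.
assert (N2 : RtoC 2 <> 0) by (apply RtoC_neq_0; lra).
assert (N3 : RtoC 3 <> 0) by (apply RtoC_neq_0; lra).
split.
- transitivity ((1 + 1) * b 2%nat / 2)%C; [field; auto | rewrite H1; field; auto].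
- transitivity ((1 + 1 + 1) * b 3%nat / 3)%C; [field; auto | rewrite H2; field; auto].
Qed.

Lemma class_F_bound (alpha : R) (lam delta : C) (f h g : C -> C) (a b : nat -> C) :
  1 < alpha -> class_F alpha lam f h g a b ->
  Cmod (b 3%nat - delta * b 2%nat ^ 2)%C
    <= 2 * (alpha - 1) * Cmod lam / 3 + Cmod delta * Cmod lam ^ 2 / 4.
Proof.
intros Halpha [[_ _ _ _ _ _ Ha1 _ Hh Hg] Hnz Hre Hdil].
assert (Ha2 : Cmod (a 2%nat) <= alpha - 1).
{ apply (second_coefficient_bound _ _ h); auto; [lra|].
  intros z Hz; specialize (Hre z Hz); rewrite re_plus in Hre; simpl (Re 1) in Hre; lra. }
destruct (coanalytic_coefficients lam a b Ha1) as [-> ->].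
{ intros n; now apply dilatation_coefficients with h g. }
replace (2 * a 2%nat * lam / 3 - delta * (lam / 2) ^ 2)%C
  with (RtoC (2 / 3) * a 2%nat * lam + - (RtoC (/ 4) * delta * lam ^ 2))%C.
2:{ rewrite RtoC_div, RtoC_inv by lra; field; split; apply RtoC_neq_0; lra. }
eapply Rle_trans; [apply Cmod_triangle|].
rewrite Cmod_opp, !Cmod_mult, !Cmod_R, Cmod_pow, !Rabs_pos_eq by lra.
assert (Cmod (a 2%nat) * Cmod lam <= (alpha - 1) * Cmod lam)
  by (apply Rmult_le_compat_r; [apply Cmod_ge_0 | exact Ha2]).
lra.
Qed.

(** * The extremal function *)

(** The Taylor coefficients of (1 - z)^beta at 0. *)
Fixpoint binom_coef (beta : R) (n : nat) : R :=
  match n with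
  | O => 1
  | S m => binom_coef beta m * ((INR m - beta) / INR (S m))
  end.

Lemma binom_coef_rec (beta : R) (n : nat) :
  INR (S n) * binom_coef beta (S n) = (INR n - beta) * binom_coef beta n.
Proof. cbn [binom_coef]; field; apply not_0_INR; lia. Qed.

Definition rotated_binom (beta : R) (u : C) (n : nat) : C :=
  (RtoC (binom_coef beta n) * u ^ n)%C.

Section Binomial.
Variable beta : R.
Hypothesis Hbeta : 0 < beta <= 1.
Let c := binom_coef beta.

Lemma binom_coef_nonpos (n : nat) : c (S n) <= 0.
Proof.
unfold c; induction n as [|n IH].
- simpl; lra.
- pose proof (pos_INR (S n)); pose proof (pos_INR n).
  assert (P : 0 < INR (S (S n))) by (apply lt_0_INR; lia).
  apply (Rmult_le_reg_l _ _ _ P); rewrite Rmult_0_r, binom_coef_rec.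
  rewrite S_INR; rewrite S_INR in *; nra.
Qed.

(** By induction, beta (c_0 + ... + c_n) = - (n+1) c_(n+1), which is
    nonnegative; as c_0 = 1 and the other coefficients are nonpositive, their
    moduli sum to at most 1. *)
Lemma binom_coef_sum (n : nat) :
  sum_n (fun k => Rabs (c (S k))) n <= 1.
Proof.
assert (T : beta * (1 - sum_n (fun k => Rabs (c (S k))) n) = - INR (S (S n)) * c (S (S n))).
{ assert (Rc : forall k, INR (S k) * c (S k) = (INR k - beta) * c k)
    by exact (binom_coef_rec beta).
  induction n as [|n IH].
  - rewrite sum_O, Rabs_left1 by apply binom_coef_nonpos.
    rewrite Ropp_mult_distr_l_reverse, Rc; assert (R0 := Rc 0%nat).
    simpl INR in *; replace (c 0%nat) with 1 in R0 by reflexivity.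
    replace (c 1%nat) with (- beta) by lra; ring.
  - rewrite sum_Sn; change plus with Rplus.
    rewrite Ropp_mult_distr_l_reverse, Rc.
    rewrite (Rabs_left1 (c (S (S n)))) by apply binom_coef_nonpos.
    lra. }
pose proof (binom_coef_nonpos (S n)); pose proof (pos_INR (S (S n))).
apply Rnot_lt_le; intros Hlt; nra.
Qed.

Lemma binom_coef_abs (n : nat) : Rabs (c n) <= 1.
Proof.
destruct n as [|n]; [unfold c; simpl; rewrite Rabs_R1; lra|].
eapply Rle_trans; [|apply (binom_coef_sum n)].
destruct n as [|n]; [rewrite sum_O; lra|].
rewrite sum_Sn; change plus with Rplus.
assert (0 <= sum_n (fun k => Rabs (c (S k))) n); [|lra].
clear; induction n as [|n IH]; [rewrite sum_O; apply Rabs_pos|].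
rewrite sum_Sn; change plus with Rplus; pose proof (Rabs_pos (c (S (S n)))); lra.
Qed.

Variable u : C.
Hypothesis Hu : Cmod u = 1.
Let e := rotated_binom beta u.

Lemma Cmod_rotated_binom (n : nat) : Cmod (e n) = Rabs (c n).
Proof. unfold e, rotated_binom; rewrite Cmod_mult, Cmod_R, Cmod_pow, Hu, pow1; apply Rmult_1_r. Qed.

Lemma rotated_binomial_ode (F : C -> C) : sums_on_disk e F ->
  forall z, unit_disk z -> ((1 - u * z) * C_derive F z)%C = (- RtoC beta * u * F z)%C.
Proof.
intros HF z Hz.
assert (HF1 := proj2 (sums_on_disk_derive _ _ HF)).
assert (S1 := sums_on_disk_minus _ _ _ _ HF1 (sums_on_disk_shift_scal u _ _ HF1)).
assert (S2 := sums_on_disk_scal (- RtoC beta * u)%C _ _ HF).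
replace ((1 - u * z) * C_derive F z)%C with (C_derive F z - u * z * C_derive F z)%C by ring.
revert z Hz; refine (sums_on_disk_fun_unique _ _ _ S1 _).
revert S2; apply sums_on_disk_ext; [|reflexivity].
intros n.
assert (R : forall m, dcoef e m = (RtoC ((INR m - beta) * c m) * u ^ S m)%C).
{ intros m; unfold dcoef, e, rotated_binom, c; rewrite <- binom_coef_rec, RtoC_mult; ring. }
rewrite R; destruct n as [|n]; unfold shift_scal, e, rotated_binom; fold c.
- rewrite RtoC_mult, RtoC_minus; simpl INR; simpl pow; simpl; ring.
- rewrite R, RtoC_mult, RtoC_minus, !Cpow_S.
  assert (Rc : (RtoC (INR (S n)) * RtoC (c (S n)))%C = RtoC ((INR n - beta) * c n))
    by (unfold c; now rewrite <- binom_coef_rec, RtoC_mult).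
  rewrite <- Rc; ring.
Qed.

(** F = 1 + z G where the coefficients of G have moduli of sum at most 1, so
    |F - 1| <= |z| < 1. *)
Lemma rotated_binomial_nonzero (F : C -> C) : sums_on_disk e F ->
  forall z, unit_disk z -> F z <> RtoC 0.
Proof.
intros HF z Hz.
destruct (conv_disk_sum (fun n => e (S n))) as [G HG].
{ apply (conv_disk_bounded _ 1); intros n; rewrite Cmod_rotated_binom; apply binom_coef_abs. }
assert (HGz : Cmod (G z) <= 1).
{ apply (cseries_bound (fun n => e (S n) * z ^ n)%C); [apply is_pseries_C, HG, Hz|].
  intros n; eapply Rle_trans; [|apply (binom_coef_sum n)].
  assert (L : forall k, Cmod (e (S k) * z ^ k) <= Rabs (c (S k))).
  { intros k; rewrite Cmod_mult, Cmod_rotated_binom, Cmod_pow.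
    rewrite <- (Rmult_1_r (Rabs (c (S k)))) at 2.
    apply Rmult_le_compat_l; [apply Rabs_pos|].
    rewrite <- (pow1 k); apply pow_incr; split; [apply Cmod_ge_0 | now apply Rlt_le]. }
  induction n as [|n IH]; [rewrite !sum_O; apply L|].
  rewrite !sum_Sn; apply Rplus_le_compat; [exact IH | apply L]. }
assert (E : F z = (1 + z * G z)%C).
{ apply (cseries_unique (fun n => e n * z ^ n)%C); [apply is_pseries_C, HF, Hz|].
  apply is_series_decr_1.
  generalize (cseries_scal z _ _ (proj1 (is_pseries_C _ _ _) (HG z Hz))).
  apply cseries_ext; [intros n; simpl; ring|].
  change ((z * G z)%C = (1 + z * G z + - (RtoC 1 * 1 * 1))%C); ring. }
rewrite E; intros E0.
assert (E1 : (z * G z)%C = (- (1))%C) by (rewrite <- (Cplus_0_l (- (1))), <- E0; ring).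
apply (f_equal Cmod) in E1; rewrite Cmod_mult, Cmod_m1 in E1.
unfold unit_disk in Hz; pose proof (Cmod_ge_0 z); pose proof (Cmod_ge_0 (G z)); nra.
Qed.

(** With w = u z the equation reads z F' / F = beta (1 - 1 / (1 - w)), and
    Re (1 / (1 - w)) > 1/2 on the unit disk. *)
Lemma rotated_binomial_real_part (F : C -> C) : sums_on_disk e F ->
  forall z, unit_disk z -> Re (1 + z * C_derive F z / F z)%C < 1 + beta / 2.
Proof.
intros HF z Hz.
assert (HF0 := rotated_binomial_nonzero F HF z Hz).
assert (Hode := rotated_binomial_ode F HF z Hz).
assert (Hw : Cmod (u * z) < 1) by (rewrite Cmod_mult, Hu, Rmult_1_l; exact Hz).
assert (Hw1 : (1 - u * z)%C <> 0).
{ intros E; replace (u * z)%C with (1 - (1 - u * z))%C in Hw by ring.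
  rewrite E in Hw; replace (1 - 0)%C with (RtoC 1) in Hw by ring.
  rewrite Cmod_1 in Hw; lra. }
assert (E : (z * C_derive F z / F z)%C = (RtoC beta * (1 - / (1 - u * z)))%C).
{ transitivity (z * ((1 - u * z) * C_derive F z) / (F z * (1 - u * z)))%C;
    [field; auto | rewrite Hode; field; auto]. }
rewrite E; clear E Hode.
set (w := (u * z)%C) in *; destruct w as [x y].
assert (Hxy : x * x + y * y < 1).
{ pose proof (Cmod2_alt (x, y)) as Hsq; unfold Re, Im in Hsq; simpl fst in Hsq; simpl snd in Hsq.
  pose proof (Cmod_ge_0 (x, y)); nra. }
assert (Hx : 0 < (1 - x) * (1 - x) + y * y) by nra.
assert (Hinv : / 2 < (1 - x) / ((1 - x) * (1 - x) + y * y)).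
{ apply (Rmult_lt_reg_r _ _ _ Hx); unfold Rdiv; rewrite Rmult_assoc, Rinv_l by lra; nra. }
assert (ER : Re (1 + RtoC beta * (1 - / (1 - (x, y))))%C
   = 1 + beta * (1 - (1 - x) / ((1 - x) * (1 - x) + y * y))).
{ unfold Re; simpl; field; lra. }
rewrite ER; nra.
Qed.

End Binomial.

(** Rotate x and y onto the positive axis by v and w, and take u = v / w. *)
Lemma exists_rotation_aligning (x y : C) :
  exists u : C, Cmod u = 1 /\ Cmod (u * x + y)%C = Cmod x + Cmod y.
Proof.
destruct (rotation_to_modulus x) as [v [Hv Hvx]].
destruct (rotation_to_modulus y) as [w [Hw Hwy]].
assert (Hw0 : w <> 0) by (apply Cmod_gt_0; lra).
exists (v / w)%C; split; [rewrite Cmod_div, Hv, Hw by exact Hw0; field|].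
replace (v / w * x + y)%C with ((v * x + w * y) / w)%C by (field; exact Hw0).
rewrite Hvx, Hwy, Cmod_div, Hw by exact Hw0.
rewrite <- RtoC_plus, Cmod_R, Rabs_pos_eq by (pose proof (Cmod_ge_0 x); pose proof (Cmod_ge_0 y); lra).
field.
Qed.

Definition primitive_coef (e : nat -> C) (n : nat) : C :=
  match n with O => RtoC 0 | S m => (e m / RtoC (INR (S m)))%C end.

Lemma dcoef_primitive_coef (e : nat -> C) (n : nat) : dcoef (primitive_coef e) n = e n.
Proof.
unfold dcoef, primitive_coef; field; apply RtoC_neq_0, not_0_INR; lia.
Qed.

Lemma primitive_on_disk (e : nat -> C) (M : R) :
  (forall n, Cmod (e n) <= M) ->
  exists f, sums_on_disk (primitive_coef e) f /\ sums_on_disk e (C_derive f).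
Proof.
intros He.
destruct (conv_disk_sum (primitive_coef e)) as [f Hf].
{ apply (conv_disk_bounded _ M); intros [|n]; unfold primitive_coef.
  - rewrite Cmod_0; eapply Rle_trans; [apply Cmod_ge_0 | apply (He 0%nat)].
  - assert (P : 1 <= INR (S n)) by (rewrite S_INR; pose proof (pos_INR n); lra).
    rewrite Cmod_div, Cmod_R, Rabs_pos_eq by (try apply RtoC_neq_0; lra).
    apply Rle_trans with (Cmod (e n)); [|apply He].
    apply (Rmult_le_reg_r (INR (S n))); [lra|].
    unfold Rdiv; rewrite Rmult_assoc, Rinv_l, Rmult_1_r by lra.
    pose proof (Cmod_ge_0 (e n)); nra. }
exists f; split; [exact Hf|].
apply sums_on_disk_ext with (dcoef (primitive_coef e)) (C_derive f);
  [apply dcoef_primitive_coef | reflexivity | now apply sums_on_disk_derive].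
Qed.

Lemma sums_on_disk_analytic (a : nat -> C) (f : C -> C) :
  sums_on_disk a f -> analytic_in_disk f.
Proof.
intros H z Hz; destruct (sums_on_disk_cderiv a f H z Hz) as [l [_ Hl]].
exists l; apply cderiv_is_derive, Hl.
Qed.

(** By the Cauchy-Riemann equations the operator is h -> h' on analytic
    functions and annihilates their conjugates. *)
Lemma wirtinger_dz_harmonic (h g : C -> C) (z dh dg : C) :
  cderiv h z dh -> cderiv g z dg ->
  wirtinger_dz (fun w => h w + Cconj (g w))%C z = dh.
Proof.
intros Hh Hg; destruct z as [x y].
destruct (cderiv_curve h (fun s => s) (fun _ => y) x 1 0 dh Hh
  (is_derive_id x) (is_derive_const y x)) as [hx1 hx2].
destruct (cderiv_curve g (fun s => s) (fun _ => y) x 1 0 dg Hg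
  (is_derive_id x) (is_derive_const y x)) as [gx1 gx2].
destruct (cderiv_curve h (fun _ => x) (fun s => s) y 0 1 dh Hh
  (is_derive_const x y) (is_derive_id y)) as [hy1 hy2].
destruct (cderiv_curve g (fun _ => x) (fun s => s) y 0 1 dg Hg
  (is_derive_const x y) (is_derive_id y)) as [gy1 gy2].
change (wirtinger_dz (fun w => h w + Cconj (g w))%C (x, y)) with
  (((Derive (fun s => Re (h (s, y)) + Re (g (s, y)))%R x,
     Derive (fun s => Im (h (s, y)) - Im (g (s, y)))%R x)
   - Ci * (Derive (fun s => Re (h (x, s)) + Re (g (x, s)))%R y,
     Derive (fun s => Im (h (x, s)) - Im (g (x, s)))%R y)) / 2)%C.
rewrite !Derive_plus, !Derive_minus by (eexists; eassumption).
rewrite (is_derive_unique _ _ _ hx1), (is_derive_unique _ _ _ hx2),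
  (is_derive_unique _ _ _ gx1), (is_derive_unique _ _ _ gx2),
  (is_derive_unique _ _ _ hy1), (is_derive_unique _ _ _ hy2),
  (is_derive_unique _ _ _ gy1), (is_derive_unique _ _ _ gy2).
destruct dh as [p q]; destruct dg as [p' q'].
apply injective_projections; simpl; field.
Qed.

Theorem theorem3 (alpha : R) (lam delta : C)
  (Halpha : 1 < alpha <= 3 / 2) (Hlam : Cmod lam <= 1 / 2) :
  (forall (f h g : C -> C) (a b : nat -> C),
     class_F alpha lam f h g a b ->
     Cmod (b 3%nat - delta * b 2%nat ^ 2)%C
       <= 2 * (alpha - 1) * Cmod lam / 3 + Cmod delta * Cmod lam ^ 2 / 4)
  /\
  (exists (f h g : C -> C) (a b : nat -> C),
     class_F alpha lam f h g a b /\
     Cmod (b 3%nat - delta * b 2%nat ^ 2)%C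
       = 2 * (alpha - 1) * Cmod lam / 3 + Cmod delta * Cmod lam ^ 2 / 4).
Proof.
split; [intros f h g a b; apply class_F_bound; lra|].
set (beta := 2 * (alpha - 1)).
assert (Hbeta : 0 < beta <= 1) by (unfold beta; lra).
(* The extremal has b_3 - delta b_2^2 = - (u x + y) with x and y as follows. *)
destruct (exists_rotation_aligning (RtoC (2 * (alpha - 1) / 3) * lam)
  (RtoC (/ 4) * delta * lam ^ 2)) as [u [Hu Hal]].
set (e := rotated_binom beta u).
assert (He : forall n, Cmod (e n) <= 1).
{ intros n; unfold e; rewrite (Cmod_rotated_binom beta u Hu); now apply binom_coef_abs. }
destruct (primitive_on_disk e 1 He) as [h [Hh Hh1]].
destruct (primitive_on_disk (shift_scal lam e) 1) as [g [Hg Hg1]].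
{ intros [|n]; unfold shift_scal; [rewrite Cmod_0; lra|].
  rewrite Cmod_mult; specialize (He n).
  apply Rle_trans with (1 / 2 * 1); [|lra].
  apply Rmult_le_compat; auto using Cmod_ge_0. }
assert (Hnz := rotated_binomial_nonzero beta Hbeta u Hu _ Hh1).
assert (Hre := rotated_binomial_real_part beta Hbeta u Hu _ Hh1).
assert (Hdil : forall z, unit_disk z -> C_derive g z = (lam * z * C_derive h z)%C)
  by exact (sums_on_disk_fun_unique _ _ _ Hg1 (sums_on_disk_shift_scal lam _ _ Hh1)).
set (a := primitive_coef e) in *; set (b := primitive_coef (shift_scal lam e)) in *.
assert (Ha1 : a 1%nat = RtoC 1) by (unfold a, e, rotated_binom; simpl; field; apply RtoC_neq_0; lra).
exists (fun z => h z + Cconj (g z))%C, h, g, a, b; split; [split; [split|..]|].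
- exact (sums_on_disk_analytic _ _ Hh).
- exact (sums_on_disk_analytic _ _ Hg).
- reflexivity.
- rewrite (sums_on_disk_at_0 _ _ Hh), (sums_on_disk_at_0 _ _ Hg); unfold a, b; simpl.
  apply injective_projections; simpl; ring.
- rewrite (wirtinger_dz_harmonic h g 0 (C_derive h 0) (C_derive g 0)).
  + rewrite (sums_on_disk_at_0 _ _ Hh1); unfold e, rotated_binom; simpl; ring.
  + apply (sums_on_disk_derive _ _ Hh), unit_disk_0.
  + apply (sums_on_disk_derive _ _ Hg), unit_disk_0.
- reflexivity.
- exact Ha1.
- reflexivity.
- exact Hh.
- exact Hg.
- exact Hnz.
- intros z Hz; specialize (Hre z Hz); unfold beta in Hre; lra.
- exact Hdil.
- destruct (coanalytic_coefficients lam a b Ha1) as [-> ->].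
  { intros n; now apply dilatation_coefficients with h g. }
  assert (Ea : (2 * a 2%nat)%C = (- RtoC beta * u)%C).
  { unfold a, e, rotated_binom; simpl; replace (1 * ((0 - beta) / 1)) with (- beta) by field.
    rewrite RtoC_opp, RtoC_plus; field; rewrite <- RtoC_plus; apply RtoC_neq_0; lra. }
  rewrite Ea.
  replace (- RtoC beta * u * lam / 3 - delta * (lam / 2) ^ 2)%C with
    (- (u * (RtoC (2 * (alpha - 1) / 3) * lam) + RtoC (/ 4) * delta * lam ^ 2))%C.
  + rewrite Cmod_opp, Hal, !Cmod_mult, !Cmod_R, Cmod_pow, !Rabs_pos_eq by lra; unfold beta; field.
  + unfold beta; rewrite RtoC_div, RtoC_inv by lra; field; split; apply RtoC_neq_0; lra.
Qed.
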